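(* Let $\psi:\mathbb{N}\to[0,\infty)$ be any function such that $S_\psi:=\sum_{q=1}^{\infty}\psi(q)^2$ converges. Let $k\in\mathbb{N}$ and assume additionally that $\psi(q)=0$ for all $q$ with more than $k$ prime divisors, counted with multiplicity. Let $0<\delta<1$ and let $\kappa=\kappa(\delta)$ be a real number with $$\kappa<\min\left\{\frac{1}{6\max_{n\in\mathbb{N}}\psi(n)},\ \frac{\delta}{\sqrt{S_\psi}}\cdot\frac{4}{3\pi^4}\cdot\frac{1}{2^k},\ \left(\frac{\delta}{S_\psi}\right)^{\frac23}\left(2\pi^2\sqrt{12}\,\left[A+B\cdot 2^{\frac{7k}{2}}\right]\right)^{-\frac23},\ \sqrt{\frac{\delta}{S_\psi}}\sqrt{\frac{1}{18\pi^2}}\right\},$$ where $$A=4.19253564643679\cdot 99684,\qquad B=27\cdot 4^{\frac{3}{16}+\frac{0.11237+0.11237^2}{2}}\,3^{\frac52}\left(\frac{1}{e\cdot 0.11237}\right)^{1+\frac{0.11237}{2}} .$$ Then $$\lambda\left(\mathcal{B}'(\psi,\kappa)\right)\geq 1-\delta .$$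
   Context: $\mathbb{N}=\{1,2,3,\dots\}$; $\lambda$ is Lebesgue measure on $\mathbb{R}$; $\lVert y\rVert$ denotes the distance from the real number $y$ to the nearest integer. For $\psi:\mathbb{N}\to[0,\infty)$ and real $\kappa$, $$\mathcal{B}'(\psi,\kappa):=\left\{x\in[0,1]:\ \max\left(\lVert qx\rVert,\lVert qx^2\rVert\right)>\kappa\,\psi(q)\ \text{ for all } q\in\mathbb{N}\right\}.$$ No monotonicity of $\psi$ is assumed. If $\psi$ is identically zero, quotients with zero denominator are read as $+\infty$. *)

(* Defs.v *)
From HB Require Import structures.
From mathcomp Require Import all_boot all_order all_algebra.
From mathcomp Require Import all_classical all_reals all_analysis.
Import Order.TTheory GRing.Theory Num.Theory.
Import numFieldNormedType.Exports.
Set Implicit Arguments.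
Unset Strict Implicit.
Unset Printing Implicit Defensive.
Local Open Scope classical_set_scope.
Local Open Scope ring_scope.

(* Functions on {1, 2, 3, ...} are represented by psi : nat -> R; the value
   psi 0 is never used.
   Quotients with zero denominator are +oo: this is the convention of inverse
   on \bar R (inve0), so bounds involving such quotients live in \bar R. *)

Definition dist_int (R : realType) (y : R) : R :=
  inf [set `|y - m%:~R| | m in [set: int]].

Definition Bprime (R : realType) (psi : nat -> R) (kappa : R) : set R :=
  [set x | x \in `[0, 1] /\ forall q : nat, (0 < q)%N ->
     kappa * psi q < Num.max (dist_int (q%:R * x)) (dist_int (q%:R * x ^+ 2))].

Definition num_prime_divisors (q : nat) : nat :=
  (\sum_(p <- primes q) logn p q)%N.

Definition sumsq (R : realType) (psi : nat -> R) : \bar R :=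
  (\sum_(1 <= q <oo) ((psi q) ^+ 2)%:E)%E.

(* The supremum is attained when sumsq psi is finite, see maxpsiP. *)
Definition maxpsi (R : realType) (psi : nat -> R) : R :=
  sup [set psi n | n in [set n : nat | (0 < n)%N]].

(* Numerals of ring_scope are unary, so decimal expansions are split into
   blocks of at most three digits. *)

(* 4.19253564643679 * 99684 *)
Definition constA (R : realType) : R :=
  (4 + 192 / 10 ^+ 3 + 535 / 10 ^+ 6 + 646 / 10 ^+ 9 + 436 / 10 ^+ 12
     + 79 / 10 ^+ 14)
  * (99 * 10 ^+ 3 + 684).

(* 0.11237 *)
Definition eps0 (R : realType) : R := 112 / 10 ^+ 3 + 37 / 10 ^+ 5.

Definition constB (R : realType) : R :=
  let e : R := eps0 R in
  27 * 4 `^ (3 / 16 + (e + e ^+ 2) / 2) * 3 `^ (5 / 2)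
  * (1 / (expR 1 * e)) `^ (1 + e / 2).

Lemma maxpsiP (R : realType) (psi : nat -> R)
    (psi_ge0 : forall q, (0 < q)%N -> 0 <= psi q)
    (Sfin : (sumsq psi < +oo)%E) :
  exists2 n, (0 < n)%N &
    maxpsi psi = psi n /\ forall m, (0 < m)%N -> psi m <= psi n.
Proof.
pose u n := psi n.+1 ^+ 2.
have u_ge0 n : 0 <= u n by rewrite /u sqr_ge0.
have Sge0 : (0 <= sumsq psi)%E.
  by apply: nneseries_ge0 => n _ _; rewrite lee_fin sqr_ge0.
have Snum : sumsq psi \is a fin_num by rewrite ge0_fin_numE.
have cvu : cvgn (series u).
  apply: nondecreasing_is_cvgn.
    by apply/nondecreasing_seqP => n; rewrite seriesSr /= lerDl.
  exists (fine (sumsq psi)) => _ [n _ <-].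
  rewrite -lee_fin fineK// /series /= -sumEFin.
  have -> : (\sum_(0 <= i < n) (u i)%:E
      = \sum_(1 <= i < n.+1) ((psi i) ^+ 2)%:E)%E by rewrite big_add1.
  by apply: nneseries_lim_ge => k _ _; rewrite lee_fin sqr_ge0.
have u0 := cvg_series_cvg_0 cvu.
suff [n n0 nmax] : exists2 n, (0 < n)%N & forall m, (0 < m)%N -> psi m <= psi n.
  exists n => //; split => //; apply/le_anti/andP; split.
    by apply: ge_sup; [exists (psi n), n|move=> _ [m m0 <-]; exact: nmax].
  by apply: ub_le_sup; [exists (psi n) => _ [m m0 <-]; exact: nmax|exists n].
have [psi0|] := pselect (forall m, (0 < m)%N -> psi m = 0).
  by exists 1%N => // m m0; rewrite !psi0.
move=> /existsNP[n0 /not_implyP[n0_gt0 /eqP psi_neq0]].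
have psi_gt0 : 0 < psi n0 by rewrite lt_def psi_neq0 psi_ge0.
have c_gt0 : 0 < psi n0 ^+ 2 by rewrite exprn_gt0.
move/cvgrPdist_lt : u0 => /(_ _ c_gt0)[N _ HN].
have small m : (N < m)%N -> psi m <= psi n0.
  move=> Nm; have m_gt0 : (0 < m)%N by exact: leq_trans Nm.
  have /= := HN m.-1; rewrite /u prednK// sub0r normrN ger0_norm ?sqr_ge0//.
  rewrite -ltnS prednK// => /(_ Nm); rewrite ltr_pXn2r// ?nnegrE ?psi_ge0//.
  exact: ltW.
pose M := maxn N n0.
pose i0 : 'I_M := Ordinal (leq_trans (eq_leq (prednK n0_gt0)) (leq_maxr N n0)).
have [i _ imax] := @arg_maxP _ R _ i0 xpredT (fun i : 'I_M => psi i.+1) isT.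
have n0i : psi n0 <= psi i.+1.
  by have := imax i0 isT; rewrite /= prednK.
exists i.+1 => // m m_gt0; have [mN|Nm] := leqP m N; last first.
  exact: le_trans (small _ Nm) n0i.
have mM : (m.-1 < M)%N by rewrite prednK// leq_max mN.
by have := imax (Ordinal mM) isT; rewrite /= prednK.
Qed.

(* Main.v *)
(* If x is not in B'(psi, kappa), then for some q, with r = kappa psi(q), x lies
   within r/q of a fraction a/q with 0 <= a <= q, and expanding
   (qx)^2 = (a + (qx - a))^2 shows that a^2 is congruent mod q to some b with
   |b| <= 4rq. The measure of the exceptional set for q is thus at most 2r/q
   times the number of such a.
   - b = 0: writing q = s f^2 so that q | a^2 forces s f | a, there are at most
     2f such a. As q |-> (s, f) is injective, sum_q 1/(s f)^2 <= zeta(2)^2 <= 4,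
     and AM-GM absorbs the sum of 4r/(s f).
   - b <> 0: if a^2 = c^2 mod q, then some d | q has d | a + c and
     (q/d) | a - c. With h = gcd(d, q/d), each d accounts for at most h classes
     a, and for none unless h | 2c, which gives h^2 | 4b. Summing h over the
     0 < |b| <= M with h^2 | 4b yields at most 8M per d, and q has at most
     2^k divisors.
   With eta = 4 delta / (3 pi^4 2^k), so that kappa^2 S <= eta^2 and (as pi >= 2)
   12 * 2^k * eta <= delta, the total is at most
   10 eta + 64 * 2^k * eta^2 <= delta. *)
Require Import Defs.
From HB Require Import structures.
From mathcomp Require Import all_boot all_order all_algebra.
From mathcomp Require Import all_classical all_reals all_analysis.
From mathcomp Require Import ring lra.
Import Order.TTheory GRing.Theory Num.Theory.
Import numFieldNormedType.Exports.
Local Open Scope ring_scope.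

(** * Squares close to 0 modulo q *)

(** Let [g] be the least positive integer with [q %| g ^ 2]. If [q %| a ^ 2], then [q ^ 2] divides
    [(a * g) ^ 2], so [q %| a * g], and [q] divides the square of [a %% g] as well; minimality gives
    [g %| a]. In particular [g %| q], and from [q = f * g] and [g ^ 2 = s * q] follows
    [g = s * f]. *)
Lemma sq_divisor_decomposition (q : nat) : (0 < q)%N ->
  exists s f : nat, q = (s * f ^ 2)%N /\
    forall a : nat, (q %| a ^ 2)%N -> (s * f %| a)%N.
Proof.
move=> q0.
have ex : exists g, (0 < g)%N && (q %| g ^ 2)%N.
  by exists q; rewrite q0 dvdn_exp.
case: (ex_minnP ex) => g /andP[g0 qg] gmin.
have gdvd a : (q %| a ^ 2)%N -> (g %| a)%N.
  move=> qa; rewrite /dvdn; apply/negPn/negP; rewrite -lt0n => b0.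
  have qag : (q %| a * g)%N.
    by rewrite -(@dvdn_pexp2r _ _ 2)// expnMn [X in (X %| _)%N]expnS expn1 dvdn_mul.
  have ba : (a %% g = a - a %/ g * g)%N by rewrite {2}(divn_eq a g) addKn.
  have le_a : (a %/ g * g <= a)%N by exact: leq_divM.
  have qb : (q %| (a %% g) ^ 2)%N.
    rewrite ba sqrnB// dvdn_sub//.
      by rewrite dvdn_add// expnMn dvdn_mull.
    by apply: dvdn_mull; rewrite [(a %/ g * g)%N]mulnC mulnA dvdn_mulr.
  by have := gmin _ (introT andP (conj b0 qb)); rewrite leqNgt ltn_pmod.
have gq : (g %| q)%N by apply: gdvd; rewrite dvdn_exp.
case/dvdnP: (gq) => f qE; case/dvdnP: qg => s gE.
have sf : (s * f = g)%N.
  by apply/eqP; rewrite -(eqn_pmul2r g0) mulnn gE -mulnA -qE.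
exists s, f; rewrite sf; split=> //.
by rewrite qE -sf mulnCA mulnn.
Qed.

(** * Number of divisors *)

(** A divisor of [p * m] is either prime to [p], hence a divisor of [m], or [p] times a divisor of
    [m]. *)
Lemma size_divisors_primeM (p m : nat) : prime p -> (0 < m)%N ->
  (size (divisors (p * m)) <= 2 * size (divisors m))%N.
Proof.
move=> pp m0; rewrite mul2n -addnn -{2}(size_map (muln p) (divisors m)) -size_cat.
have pm0 : (0 < p * m)%N by rewrite muln_gt0 prime_gt0.
apply: uniq_leq_size (divisors_uniq _) _ => d.
rewrite mem_cat -!dvdn_divisors// => dpm.
have [pd|/negbTE pd] := boolP (p %| d)%N; last first.
  by rewrite -(@Gauss_dvdr _ p) ?dpm// coprime_sym prime_coprime// pd.
apply/orP; right; case/dvdnP: pd dpm => e ->; rewrite mulnC dvdn_pmul2l ?prime_gt0//.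
by rewrite dvdn_divisors// => em; rewrite mem_map//; move=> x y /eqP; rewrite eqn_pmul2l ?prime_gt0// => /eqP.
Qed.

(** With an index range independent of [q], the sums for [q] and for a factor of [q] can be compared
    term by term through [lognM]. *)
Lemma num_prime_divisors_widen (q B : nat) : (q < B)%N ->
  num_prime_divisors q = (\sum_(0 <= p < B) logn p q)%N.
Proof.
move=> qB; rewrite /num_prime_divisors.
rewrite [RHS](bigID (mem (primes q)))/= [X in (_ + X)%N]big1 ?addn0; last first.
  by move=> p; rewrite -logn_gt0 lt0n negbK => /eqP.
rewrite -[RHS]big_filter; apply: perm_big; apply: uniq_perm.
- exact: primes_uniq.
- by rewrite filter_uniq// iota_uniq.
move=> p; rewrite mem_filter mem_index_iota leq0n/= -[LHS]andbT.
have [pq|//] := boolP (p \in primes q).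
rewrite (leq_ltn_trans _ qB)//.
by move: pq; rewrite mem_primes => /and3P[_ q0 pq]; exact: dvdn_leq.
Qed.

Lemma size_divisors_le (q : nat) : (0 < q)%N ->
  (size (divisors q) <= 2 ^ num_prime_divisors q)%N.
Proof.
elim/ltn_ind: q => q IH q0.
have [q1|q1] := leqP q 1.
  have -> : q = 1%N by apply/eqP; rewrite eqn_leq q1.
  by rewrite /divisors/= expn_gt0.
have pp := pdiv_prime q1; set p := pdiv q in pp.
have qE : q = (p * (q %/ p))%N by rewrite mulnC divnK// pdiv_dvd.
set m := (q %/ p)%N in qE.
have m0 : (0 < m)%N by rewrite divn_gt0 ?pdiv_gt0// dvdn_leq// pdiv_dvd.
have mq : (m < q)%N by rewrite ltn_Pdiv// prime_gt1.
have pq : (p <= q)%N by rewrite dvdn_leq// pdiv_dvd.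
clearbody m p.
rewrite {1}qE (leq_trans (size_divisors_primeM _ _ pp m0))//.
have -> : num_prime_divisors q = (num_prime_divisors m).+1.
  rewrite !(num_prime_divisors_widen _ q.+1)//; last by rewrite ltnS ltnW.
  rewrite (eq_bigr (fun i => logn i p + logn i m)%N); last first.
    by move=> i _; rewrite qE lognM// prime_gt0.
  rewrite big_split/= addnC -[RHS]addn1; congr (_ + _)%N.
  rewrite (bigD1_seq p) ?iota_uniq//=; last first.
    by rewrite mem_index_iota ltnS.
  rewrite logn_prime// eqxx big1 ?addn0// => i ip.
  by rewrite logn_prime// (negbTE ip).
by rewrite expnS leq_mul2l/= IH.
Qed.

(** * Square roots modulo q *)

(** Within one class modulo [L], the quotient [a %/ L], which is below [h], determines [a]. *)
Lemma card_residue_class (q L h : nat) (T : {set 'I_q.+1}) :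
  (0 < q)%N -> (L * h = q)%N ->
  (forall a, a \in T -> (a < q)%N) ->
  (forall a b, a \in T -> b \in T -> a = b %[mod L]) -> (#|T| <= h)%N.
Proof.
move=> q0 Lh Tq TL.
have /andP[L0 h0] : (0 < L)%N && (0 < h)%N by rewrite -muln_gt0 Lh.
case: h h0 Lh => // h _ Lh.
rewrite -[X in (_ <= X)%N]card_ord.
rewrite -(card_in_imset (f := fun a : 'I_q.+1 => inord (n' := h) (a %/ L))).
  exact: max_card.
move=> a b aT bT /(congr1 val) /=.
have lt c : c \in T -> (c %/ L < h.+1)%N by move=> /Tq; rewrite ltn_divLR// mulnC Lh.
rewrite !inordK ?lt// => ab; apply: val_inj => /=.
by rewrite (divn_eq a L) (divn_eq b L) ab (TL a b).
Qed.

(** For [d %| q], the lcm of [d] and [q %/ d] is [q] divided by this gcd, so a class modulo that lcm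
    consists of [split_gcd q d] classes modulo [q]. *)
Definition split_gcd (q d : nat) : nat := gcdn d (q %/ d).

Lemma split_gcd_sq_dvd (q d : nat) : (d %| q)%N -> (split_gcd q d ^ 2 %| q)%N.
Proof.
by move=> dq; rewrite -{2}(divnK dq) -mulnn dvdn_mul// ?dvdn_gcdl ?dvdn_gcdr.
Qed.

(** Take [d = gcdn q (a + c)]: then [q %/ d] divides [(a - c) * ((a + c) %/ d)] and is coprime to
    the second factor. *)
Lemma eqmod_sq_split (q a c : nat) : (0 < q)%N -> a ^ 2 = c ^ 2 %[mod q] ->
  exists2 d, (d %| q)%N & (d %| a + c)%N /\ a = c %[mod q %/ d].
Proof.
move=> q0; wlog le_ca : a c / (c <= a)%N.
  move=> wl; have [ca|ac] := leqP c a; first exact: wl.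
  move=> /esym /(wl _ _ (ltnW ac))[d dq [d1 d2]].
  by exists d => //; rewrite addnC; split.
move=> /eqP; rewrite eqn_mod_dvd ?leq_sqr// subn_sqr => qac.
exists (gcdn q (a + c)); first exact: dvdn_gcdl.
split; first exact: dvdn_gcdr.
have d0 : (0 < gcdn q (a + c))%N by rewrite gcdn_gt0 q0.
apply/eqP; rewrite eqn_mod_dvd//.
rewrite -(@Gauss_dvdl _ _ ((a + c) %/ gcdn q (a + c))).
  by rewrite -(@dvdn_pmul2r (gcdn q (a + c)))// -mulnA !divnK ?dvdn_gcdl ?dvdn_gcdr.
rewrite /coprime -(eqn_pmul2r d0) mul1n muln_gcdl !divnK ?dvdn_gcdl ?dvdn_gcdr//.
Qed.

Lemma eqn_mod_lcm (m n a b : nat) :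
  a = b %[mod m] -> a = b %[mod n] -> a = b %[mod lcmn m n].
Proof.
wlog ab : a b / (b <= a)%N.
  by move=> wl; have [/wl//|/ltnW/wl w /esym/w {}w /esym/w] := leqP b a.
move=> /eqP + /eqP; rewrite !eqn_mod_dvd// => ma na.
by apply/eqP; rewrite eqn_mod_dvd// dvdn_lcm ma.
Qed.

(** The roots are sorted by the [d] of [eqmod_sq_split]. For fixed [d], [a] is [-c] modulo [d] and
    [c] modulo [q %/ d], hence is determined modulo their lcm. If such an [a] exists, the gcd
    divides both [a + c] and [a - c], hence [2 * c]. *)
Lemma card_sqrt_mod (q c : nat) : (0 < q)%N ->
  (#|[set a : 'I_q.+1 | (a < q)%N && (a ^ 2 == c ^ 2 %[mod q])]| <=
   \sum_(d <- divisors q | split_gcd q d %| 2 * c) split_gcd q d)%N.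
Proof.
move=> q0.
pose T d : {set 'I_q.+1} := [set a : 'I_q.+1 |
  [&& (a < q)%N, (d %| a + c)%N & a == c %[mod q %/ d]]].
have Th d : (d %| q)%N -> (#|T d| <= split_gcd q d)%N.
  move=> dq; apply: (@card_residue_class _ (lcmn d (q %/ d))) => //.
  - by rewrite /split_gcd muln_lcm_gcd mulnC divnK.
  - by move=> a; rewrite inE => /and3P[].
  move=> a b; rewrite !inE => /and3P[_ da /eqP qa] /and3P[_ db /eqP qb].
  apply: eqn_mod_lcm; last by rewrite qa qb.
  by apply/eqP; rewrite -(eqn_modDr c) (eqP da) (eqP db).
have Tc d a : (d %| q)%N -> a \in T d -> (split_gcd q d %| 2 * c)%N.
  move=> dq; rewrite inE => /and3P[_ da /eqP qa].
  rewrite mul2n -addnn /dvdn.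
  have := congr1 (modn^~ (split_gcd q d)) qa.
  rewrite !modn_dvdm ?dvdn_gcdr// => ac.
  by rewrite -modnDml -ac modnDml -[_ == _]/(_ %| _)%N (dvdn_trans _ da)// dvdn_gcdl.
apply: (@leq_trans (\sum_(d <- divisors q) #|T d|)%N).
  rewrite (leq_trans (subset_leq_card (B := \bigcup_(d <- divisors q) T d)%SET _))//.
    apply/fintype.subsetP => a; rewrite inE => /andP[aq /eqP ac].
    have [d dq [d1 d2]] := eqmod_sq_split _ _ _ q0 ac.
    rewrite (big_rem d) -?dvdn_divisors//= inE; apply/orP; left.
    by rewrite inE aq d1 d2 eqxx.
  elim: (divisors q) => [|d s IH]; first by rewrite !big_nil cards0.
  by rewrite !big_cons (leq_trans (leq_card_setU _ _))// leq_add2l.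
rewrite [X in (_ <= X)%N]big_mkcond big_seq [X in (_ <= X)%N]big_seq.
apply: leq_sum => d; rewrite -dvdn_divisors// => dq.
case: ifPn => [_|nd]; first exact: Th.
rewrite leqn0 cards_eq0; apply/eqP/setP => a; rewrite [RHS]inE.
by apply/negbTE; apply: contra nd; exact: Tc.
Qed.

(** The abstract [P] serves for both signs of [b]. One element [c] of [P] is fixed and the others
    are square roots of [c ^ 2]. With [h = split_gcd q d], [h %| 2 * c] gives [h ^ 2 %| 4 * c ^ 2];
    as [h ^ 2 %| q], this becomes [h ^ 2 %| 4 * b], a condition free of [c]. *)
Lemma card_sqrt_mod_pm (q b : nat) (P : pred nat) : (0 < q)%N ->
  (forall a c, P a -> P c -> a ^ 2 = c ^ 2 %[mod q]) ->
  (forall a, P a -> a ^ 2 = b %[mod q] \/ (q %| a ^ 2 + b)%N) ->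
  (#|[set a : 'I_q.+1 | (a < q)%N && P a]| <=
   \sum_(d <- divisors q | split_gcd q d ^ 2 %| 4 * b) split_gcd q d)%N.
Proof.
move=> q0 PP Pb.
have [->|[c]] := set_0Vmem [set a : 'I_q.+1 | (a < q)%N && P a].
  by rewrite cards0.
rewrite inE => /andP[_ Pc].
apply: (@leq_trans #|[set a : 'I_q.+1 | (a < q)%N && (a ^ 2 == c ^ 2 %[mod q])]|).
  apply: subset_leq_card; apply/fintype.subsetP => a; rewrite !inE => /andP[-> Pa] /=.
  exact/eqP/PP.
rewrite (leq_trans (card_sqrt_mod _ _ q0))//.
rewrite big_mkcond [X in (_ <= X)%N]big_mkcond.
rewrite big_seq [X in (_ <= X)%N]big_seq.
apply: leq_sum => d; rewrite -dvdn_divisors// => dq.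
case: ifPn => // hc; rewrite ifT//.
have hq := split_gcd_sq_dvd _ _ dq.
have hc2 : (split_gcd q d ^ 2 %| 4 * c ^ 2)%N.
  by rewrite -[4%N]/(2 ^ 2)%N -expnMn dvdn_exp2r.
have [cb|qcb] := Pb _ Pc.
  have /eqP := congr1 (modn^~ (split_gcd q d ^ 2)%N) cb.
  rewrite !modn_dvdm// => cb'.
  by rewrite /dvdn -modnMmr -(eqP cb') modnMmr.
by rewrite -(dvdn_addr _ hc2) -mulnDr dvdn_mull// (dvdn_trans hq).
Qed.

(** The numbers [4 * b] lie among [1, ..., 4 * M], which contain [4 * M %/ m] multiples of [m]. *)
Lemma count_dvd_4mul (m M : nat) : (0 < m)%N ->
  (m * (\sum_(1 <= b < M.+1) (m %| 4 * b)) <= 4 * M)%N.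
Proof.
move=> m0; rewrite mulnC.
apply: leq_trans (leq_divM (4 * M) m); rewrite leq_mul2r; apply/orP; right.
rewrite divn_count_dvd.
elim: M => [|M IH]; first by rewrite big_geq.
rewrite big_nat_recr//= mulnS addnC.
rewrite -[(4 + 4 * M)%N]/((4 * M).+4) 4?(big_nat_recr _.+1)//=.
by rewrite addnC leq_add2r (leq_trans IH)// -!addnA leq_addr.
Qed.

(** The square of [a] is congruent modulo [q] to an integer of absolute value at most [M]; the
    disjunction separates the two signs so that everything stays in [nat]. *)
Definition near_sq (q M a : nat) : bool :=
  [exists b : 'I_M.+1, (a ^ 2 == b %[mod q]) || (q %| a ^ 2 + b)%N].

Lemma card_near_sq (q M : nat) : (0 < q)%N ->
  (#|[set a : 'I_q.+1 | near_sq q M a & ~~ (q %| a ^ 2)%N]| <=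
   8 * M * size (divisors q))%N.
Proof.
move=> q0.
pose P1 b : {set 'I_q.+1} := [set a : 'I_q.+1 | (a < q)%N && (a ^ 2 == b %[mod q])].
pose P2 b : {set 'I_q.+1} := [set a : 'I_q.+1 | (a < q)%N && (q %| a ^ 2 + b)%N].
pose W b := (\sum_(d <- divisors q | split_gcd q d ^ 2 %| 4 * b) split_gcd q d)%N.
have P1W b : (#|P1 b| <= W b)%N.
  apply: (card_sqrt_mod_pm _ _ (fun a => a ^ 2 == b %[mod q])) => //.
    by move=> a c /eqP -> /eqP ->.
  by move=> a /eqP; left.
have P2W b : (#|P2 b| <= W b)%N.
  apply: (card_sqrt_mod_pm _ _ (fun a => q %| a ^ 2 + b)%N) => //.
    by move=> a c /eqP a0 /eqP c0; apply/eqP; rewrite -(eqn_modDr b) a0 c0.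
  by move=> a; right.
apply: (@leq_trans (\sum_(1 <= b < M.+1) 2 * W b)%N).
  rewrite (leq_trans (subset_leq_card
    (B := \bigcup_(b <- index_iota 1 M.+1) (P1 b :|: P2 b))%SET _))//.
    (* Since [q] does not divide [a ^ 2], neither [b = 0] nor [a = q] can occur. *)
    apply/fintype.subsetP => a; rewrite inE => /andP[/existsP[b ab] qa].
    have b0 : (0 < b)%N.
      rewrite lt0n; apply: contra qa => /eqP b0; move: ab.
      by rewrite b0 addn0 mod0n orbb.
    have aq : (a < q)%N.
      rewrite ltn_neqAle -ltnS ltn_ord andbT; apply: contra qa => /eqP ->.
      exact: dvdn_exp.
    have bM : val b \in index_iota 1 M.+1 by rewrite mem_index_iota b0 ltn_ord.
    rewrite (big_rem _ bM)/=.
    by rewrite !inE aq/= ab.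
  elim: (index_iota 1 M.+1) => [|d s IH]; first by rewrite !big_nil cards0.
  rewrite !big_cons (leq_trans (leq_card_setU _ _))// leq_add//.
  by rewrite (leq_trans (leq_card_setU _ _))// mul2n -addnn leq_add.
rewrite -big_distrr/= /W (_ : 8 * M = 2 * (4 * M))%N; last by rewrite mulnA.
rewrite -mulnA leq_mul2l/=.
under eq_bigr do rewrite big_mkcond.
rewrite exchange_big/= -sum1_size big_distrr/=.
rewrite big_seq [X in (_ <= X)%N]big_seq.
apply: leq_sum => d; rewrite -dvdn_divisors// => dq; rewrite muln1.
set h := split_gcd q d.
have h0 : (0 < h)%N by rewrite gcdn_gt0 (dvdn_gt0 q0 dq).
(* For fixed [d] the sum is [h] times the number of [b] with [h ^ 2 %| 4 * b]; as [h <= h ^ 2], it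
   is at most [4 * M]. *)
apply: leq_trans (count_dvd_4mul (h ^ 2) M _); last by rewrite expn_gt0 h0.
rewrite (_ : (\sum_(1 <= b < M.+1) _ = h * \sum_(1 <= b < M.+1) (h ^ 2 %| 4 * b))%N); last first.
  by rewrite big_distrr/=; apply: eq_bigr => b _; case: ifP; rewrite ?muln1 ?muln0.
by rewrite leq_mul2r -mulnn leq_pmulr ?orbT.
Qed.

(** As [q = (s * f) * f], there are [f + 1] multiples of [s * f] from [0] to [q], both ends
    included, and [f >= 1]. *)
Lemma card_dvd_sq (q s f : nat) : (0 < q)%N -> q = (s * f ^ 2)%N ->
  (forall a : nat, (q %| a ^ 2)%N -> (s * f %| a)%N) ->
  (#|[set a : 'I_q.+1 | (q %| a ^ 2)%N]| <= 2 * f)%N.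
Proof.
move=> q0 qE H.
have f0 : (0 < f)%N by rewrite lt0n; apply: contraL q0 => /eqP f0; rewrite qE f0 muln0.
have s0 : (0 < s)%N by rewrite lt0n; apply: contraL q0 => /eqP s0; rewrite qE s0.
have sf0 : (0 < s * f)%N by rewrite muln_gt0 s0.
apply: (@leq_trans f.+1); last by rewrite mul2n -addnn -addn1 leq_add2l.
rewrite -[X in (_ <= X)%N]card_ord.
rewrite -(card_in_imset (f := fun a : 'I_q.+1 => inord (n' := f) (a %/ (s * f)))).
  exact: max_card.
have lt (c : 'I_q.+1) : (c %/ (s * f) < f.+1)%N.
  rewrite ltn_divLR// (leq_trans (ltn_ord c))//.
  by rewrite mulSn mulnCA mulnn -qE -add1n leq_add2r.
move=> a b; rewrite !inE => /H ha /H hb /(congr1 val) /=.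
rewrite !inordK ?lt// => ab; apply: val_inj => /=.
by rewrite -(divnK ha) ab divnK.
Qed.

(** * Measure of the exceptional sets *)

Lemma sum_inv_sq_le2 (R : realType) (N : nat) :
  \sum_(1 <= n < N) (n%:R ^+ 2)^-1 <= 2 :> R.
Proof.
case: N => [|[|N]]; [by rewrite big_geq..|].
(* The bound is sharpened by a telescoping term so that it can be proved by induction. *)
suff : \sum_(1 <= n < N.+2) (n%:R ^+ 2)^-1 <= 2 - N.+1%:R^-1 :> R.
  by move=> /le_trans; apply; rewrite gerBl.
elim: N => [|N IH]; first by rewrite big_nat1 expr1n invr1; lra.
rewrite big_nat_recr//= (le_trans (lerD IH (lexx _)))//.
have n0 : 0 < N.+1%:R :> R by [].
rewrite -[N.+2]addn1 natrD.
set x := N.+1%:R in n0 *.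
have x1 : 0 < x + 1 by lra.
rewrite -subr_ge0 [leRHS](_ : _ = (x * (x + 1) ^+ 2)^-1).
  by rewrite invr_ge0 mulr_ge0 ?sqr_ge0// ltW.
by field; rewrite !gt_eqF.
Qed.

(** A pair [(s, f)] determines [q], so each pair occurs at most once, and the sum is at most the
    product of two sums of inverse squares, each at most 2. *)
Lemma sum_inv_sq_decomposition (R : realType) (s f : nat -> nat) (N : nat) :
  (forall q, (0 < q)%N -> q = (s q * f q ^ 2)%N) ->
  \sum_(1 <= q < N) ((s q * f q)%:R ^+ 2)^-1 <= 4 :> R.
Proof.
move=> qE.
pose G a b : R := (a%:R ^+ 2)^-1 * (b%:R ^+ 2)^-1.
have G0 a b : 0 <= G a b by rewrite mulr_ge0// invr_ge0 sqr_ge0.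
(* Each term is spread over all pairs [(a, b)] with an indicator; after exchanging the sums, each
   pair meets at most one [q]. *)
apply: (@le_trans _ _ (\sum_(1 <= q < N) \sum_(1 <= a < N) \sum_(1 <= b < N)
    if (q == a * b ^ 2)%N then G a b else 0)).
  rewrite big_nat [leRHS]big_nat; apply: ler_sum => q /andP[q0 qN].
  have := qE q q0; move: (s q) (f q) => {s f qE}a b qE.
  have a0 : (0 < a)%N by rewrite lt0n; apply: contraL q0 => /eqP a0; rewrite qE a0.
  have b0 : (0 < b)%N by rewrite lt0n; apply: contraL q0 => /eqP b0; rewrite qE b0 muln0.
  have aN : a \in index_iota 1 N.
    by rewrite mem_index_iota a0 (leq_ltn_trans _ qN)// qE leq_pmulr// expn_gt0 b0.
  have bN : b \in index_iota 1 N.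
    rewrite mem_index_iota b0 (leq_ltn_trans _ qN)// qE -mulnn mulnCA.
    by rewrite leq_pmulr// muln_gt0 a0.
  rewrite (big_rem _ aN)/= (big_rem _ bN)/= -qE eqxx /G natrM exprMn invfM.
  rewrite -addrA lerDl addr_ge0// sumr_ge0// => i _; last apply: sumr_ge0 => j _.
    by case: ifP.
  by case: ifP.
rewrite exchange_big/=; under eq_bigr do rewrite exchange_big/=.
apply: (@le_trans _ _ (\sum_(1 <= a < N) \sum_(1 <= b < N) G a b)).
  apply: ler_sum => a _; apply: ler_sum => b _.
  rewrite -big_mkcond/=.
  have [qN|qN] := boolP ((a * b ^ 2)%N \in index_iota 1 N).
    by rewrite -big_filter filter_pred1_uniq ?iota_uniq// big_seq1.
  rewrite big1_seq// => q /andP[/eqP-> ]; by rewrite (negbTE qN).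
rewrite /G; under eq_bigr do rewrite -mulr_sumr.
rewrite -mulr_suml.
have := sum_inv_sq_le2 R N; set t := \sum_(1 <= n < N) _ => t2.
have t0 : 0 <= t by apply: sumr_ge0 => i _; rewrite invr_ge0 sqr_ge0.
nra.
Qed.

Local Open Scope classical_set_scope.

(** The infimum is attained at the rounding of [y]: any other integer is at distance at least 1 from
    it, hence at least 1/2 from [y]. *)
Lemma dist_int_witness (R : realType) (y r : R) :
  dist_int y <= r -> exists m : int, `|y - m%:~R| <= r.
Proof.
move=> yr; exists (Num.floor (y + 2^-1)); apply: le_trans yr.
apply: lb_le_inf; first by exists `|y - 0%:~R|, 0.
move=> _ [n _ <-]; set m := Num.floor _.
have /andP[m1 m2] := floor_itv (y + 2^-1); rewrite -/m in m1 m2.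
rewrite intrD in m2.
have [->//|nm] := eqVneq n m.
have nm1 : 1 <= `|n%:~R - m%:~R| :> R.
  by rewrite -intrB -intr_norm -[1]/(1%:~R) ler_int -gtz0_ge1 normr_gt0 subr_eq0.
have ym : `|y - m%:~R| <= 2^-1 by rewrite ler_norml; apply/andP; split; lra.
have : `|n%:~R - m%:~R| <= `|y - n%:~R| + `|y - m%:~R| :> R.
  rewrite [`|y - n%:~R|]distrC (_ : n%:~R - m%:~R = (n%:~R - y) + (y - m%:~R)); last by ring.
  exact: ler_normD.
lra.
Qed.

Lemma near_sq_center (R : realType) (q : nat) (r x : R) : (0 < q)%N ->
  r < 1 -> 0 <= x <= 1 ->
  dist_int (q%:R * x) <= r -> dist_int (q%:R * x ^+ 2) <= r ->
  exists2 a : 'I_q.+1, near_sq q (Num.truncn (4 * r * q%:R)) a &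
    `|x - a%:R / q%:R| <= r / q%:R.
Proof.
move=> q0 r1 /andP[x0 x1] /dist_int_witness[m xm] /dist_int_witness[n xn].
have r0 : 0 <= r := le_trans (normr_ge0 _) xm.
have Q0 : 0 < q%:R :> R by rewrite ltr0n.
have Q1 : 1 <= q%:R :> R by rewrite ler1n.
(* As [r < 1], the integers near [q x] and [q x ^ 2] exceed [-1], hence are natural numbers;
   likewise the first is below [q + 1]. *)
have intN (z : int) : -1 < z%:~R :> R -> exists k : nat, z = k.
  by case: z => k; [exists k|rewrite NegzE mulrNz ltrN2 -[1]/(1%:~R) ltr_int].
have [a mE] : exists a : nat, m = a.
  by apply: intN; move: xm; rewrite ler_norml => /andP[]; nra.
have [b nE] : exists b : nat, n = b.
  by apply: intN; move: xn; rewrite ler_norml => /andP[]; nra.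
subst m n; rewrite -!pmulrn in xm xn.
have aq : (a < q.+1)%N.
  rewrite -(ltr_nat R) -[q.+1]addn1 natrD.
  by move: xm; rewrite ler_norml => /andP[]; nra.
exists (Ordinal aq) => /=; last first.
  rewrite (_ : x - _ = (q%:R * x - a%:R) / q%:R); last by field; rewrite gt_eqF.
  by rewrite normrM normfV (gtr0_norm Q0) ler_pM2r// invr_gt0.
(* The identity below splits the left side into a part bounded by [q r] and a part bounded by
   [3 q r], the latter because [q x + a <= 2 q + r <= 3 q]. *)
have tM : `|a%:R ^+ 2 - b%:R * q%:R| <= 4 * r * q%:R :> R.
  rewrite (_ : _ - _ = q%:R * (q%:R * x ^+ 2 - b%:R)
      - (q%:R * x - a%:R) * (q%:R * x + a%:R)); last by ring.
  apply: le_trans (ler_normB _ _) _; rewrite !normrM (gtr0_norm Q0).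
  have -> : `|q%:R * x + a%:R| = q%:R * x + a%:R.
    by rewrite ger0_norm// addr_ge0// mulr_ge0// ltW.
  have : q%:R * x + a%:R <= 3 * q%:R.
    by move: xm; rewrite ler_norml => /andP[]; nra.
  have : 0 <= q%:R * x + a%:R by rewrite addr_ge0// mulr_ge0// ltW.
  have := normr_ge0 (q%:R * x - a%:R); have := normr_ge0 (q%:R * x ^+ 2 - b%:R).
  nra.
have M0 : 0 <= 4 * r * q%:R by rewrite !mulr_ge0// ltW.
apply/existsP; have [ab|ab] := leqP (b * q) (a ^ 2).
  have cM : (a ^ 2 - b * q < (Num.truncn (4 * r * q%:R)).+1)%N.
    rewrite ltnS truncn_ge_nat// natrB// natrX natrM.
    by rewrite (le_trans _ tM)// ler_norm.
  exists (Ordinal cM) => /=; apply/orP; left.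
  by rewrite -{1}(subnKC ab) modnMDl.
have cM : (b * q - a ^ 2 < (Num.truncn (4 * r * q%:R)).+1)%N.
  rewrite ltnS truncn_ge_nat// natrB 1?ltnW// natrX natrM.
  by rewrite (le_trans _ tM)// distrC ler_norm.
exists (Ordinal cM) => /=; apply/orP; right.
by rewrite subnKC 1?ltnW// dvdn_mull.
Qed.

(* [lebesgue_measure] is an outer measure on all sets, so Bprime need not be
   shown measurable. *)
Lemma lebesgue_measure_le (R : realType) (A B : set R) : A `<=` B ->
  (lebesgue_measure A <= lebesgue_measure B)%E.
Proof. exact: (@le_outer_measure _ _ ((wlength idfun)^*)%mu). Qed.

Lemma lebesgue_measure_bigcup (R : realType) (F : (set R)^nat) :
  (lebesgue_measure (\bigcup_n F n) <= \sum_(n <oo) lebesgue_measure (F n))%E.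
Proof. exact: (outer_measure_sigma_subadditive ((wlength idfun)^*)%mu). Qed.

Lemma lebesgue_measure_bigsetU (R : realType) (F : (set R)^nat) (n : nat) :
  (lebesgue_measure (\big[setU/set0]_(i < n) F i)
     <= \sum_(i < n) lebesgue_measure (F i))%E.
Proof. exact: (outer_measure_subadditive ((wlength idfun)^*)%mu). Qed.

(** The points of [0, 1] that violate the condition of [Bprime] at [q], where [r] stands for
    [kappa * psi q]. *)
Definition bad_set (R : realType) (q : nat) (r : R) : set R :=
  [set x | [/\ 0 <= x <= 1, dist_int (q%:R * x) <= r &
               dist_int (q%:R * x ^+ 2) <= r]].

Lemma card_near_sq_le (q M s f : nat) : (0 < q)%N -> q = (s * f ^ 2)%N ->
  (forall a : nat, (q %| a ^ 2)%N -> (s * f %| a)%N) ->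
  (#|[pred a : 'I_q.+1 | near_sq q M a]| <=
   2 * f + 8 * M * 2 ^ num_prime_divisors q)%N.
Proof.
move=> q0 qE H.
rewrite -(cardsE (fun a : 'I_q.+1 => near_sq q M a)).
set A := finset _.
rewrite -(cardsID [set a : 'I_q.+1 | (q %| a ^ 2)%N]%SET A) leq_add//.
  rewrite (leq_trans _ (card_dvd_sq _ _ _ q0 qE H))// subset_leq_card//.
  exact: subsetIr.
rewrite (leq_trans _ (leq_mul (leqnn _) (size_divisors_le _ q0)))//.
rewrite (leq_trans _ (card_near_sq q M q0))// subset_leq_card//.
by apply/fintype.subsetP => a; rewrite !inE andbC.
Qed.

(** The set is covered by intervals of length [2 r / q], at most [2 f + 8 M 2 ^ k] in number when
    [r] is nonzero. The first part gives [4 r / (s f)] since [q = s f ^ 2]; the second gives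
    [64 * 2 ^ k * r ^ 2] since [M <= 4 r q]. *)
Lemma bad_set_measure (R : realType) (q k : nat) (r : R) : (0 < q)%N ->
  0 <= r -> r < 1 -> ((k < num_prime_divisors q)%N -> r = 0) ->
  exists s f : nat, q = (s * f ^ 2)%N /\
    (lebesgue_measure (bad_set R q r) <=
      (4 * r * (s * f)%:R^-1 + 64 * 2 ^+ k * r ^+ 2)%:E)%E.
Proof.
move=> q0 r0 r1 kr.
have [s [f [qE H]]] := sq_divisor_decomposition _ q0.
exists s, f; split => //.
have Q0 : 0 < q%:R :> R by rewrite ltr0n.
set M := Num.truncn (4 * r * q%:R).
pose F a : set R := if near_sq q M a then
  `[a%:R / q%:R - r / q%:R, a%:R / q%:R + r / q%:R]%classic else set0.
have cover : bad_set R q r `<=` \big[setU/set0]_(i < q.+1) F i.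
  move=> x [x01 x1 x2]; have [a na xa] := near_sq_center _ _ _ _ q0 r1 x01 x1 x2.
  rewrite -bigcup_mkord; exists a; first exact: (ltn_ord a).
  by rewrite /F na/= in_itv/= -ler_distl.
have rq0 : 0 <= r / q%:R by rewrite divr_ge0// ltW.
apply: le_trans (lebesgue_measure_le _ _ _ cover) _.
apply: (le_trans (lebesgue_measure_bigsetU _ _ _)).
apply: (@le_trans _ _ (\sum_(i < q.+1 | near_sq q M i) (2 * r / q%:R)%:E)%E).
  rewrite [leRHS]big_mkcond; apply: lee_sum => a _; rewrite /F.
  case: ifP => _; last by rewrite measure0.
  rewrite lebesgue_measure_itv/= lte_fin; case: ifP => _; rewrite ?lee_fin; last by rewrite -mulrA mulr_ge0.
  lra.
rewrite sumEFin lee_fin sumr_const -[leLHS]mulr_natl.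
have := card_near_sq_le q M s f q0 qE H.
set c := #|_|; rewrite -(ler_nat R) natrD => cle.
have ML : M%:R <= 4 * r * q%:R by rewrite truncn_le !mulr_ge0// ltW.
(* Either [q] has at most [k] prime divisors, or [r = 0] and both sides vanish. *)
have kr2 : 2 ^+ num_prime_divisors q * r ^+ 2 <= 2 ^+ k * r ^+ 2.
  have [/kr ->|le_k] := ltnP k (num_prime_divisors q).
    by rewrite expr0n !mulr0.
  by rewrite ler_wpM2r ?sqr_ge0// ler_weXn2l// ler1n.
have f0 : (f%:R : R) != 0.
  rewrite pnatr_eq0; apply: contraL q0 => /eqP f0; by rewrite qE f0 muln0.
have s0 : (s%:R : R) != 0.
  by rewrite pnatr_eq0; apply: contraL q0 => /eqP s0; rewrite qE s0.
apply: le_trans (ler_wpM2r _ cle) _; first by rewrite -mulrA mulr_ge0.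
rewrite !natrM natrX.
rewrite mulrDl lerD//.
  rewrite qE !natrM ?natrX le_eqVlt; apply/orP; left; apply/eqP.
  by field; rewrite f0.
set w := 2%:R ^+ _.
apply: (@le_trans _ _ (64 * (w * r ^+ 2))).
  rewrite [leLHS](_ : _ = (16 * w * (r / q%:R)) * M%:R); last by ring.
  apply: (@le_trans _ _ ((16 * w * (r / q%:R)) * (4 * r * q%:R))).
    by rewrite ler_wpM2l// !mulr_ge0// exprn_ge0.
  rewrite le_eqVlt; apply/orP; left; apply/eqP.
  by field; rewrite gt_eqF.
by rewrite -[leRHS]mulrA ler_wpM2l.
Qed.

(** * Summation over all q *)

Lemma sum_bad_set_bound (R : realType) (psi : nat -> R) (k : nat)
    (kappa S eta delta : R) (s f : nat -> nat) :
  (0 < k)%N -> 0 < eta -> delta < 1 -> 12 * 2 ^+ k * eta <= delta ->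
  (forall N, \sum_(1 <= q < N) psi q ^+ 2 <= S) -> kappa ^+ 2 * S <= eta ^+ 2 ->
  (forall q, (0 < q)%N -> q = (s q * f q ^ 2)%N) ->
  forall N, \sum_(1 <= q < N) (4 * (kappa * psi q) * (s q * f q)%:R^-1
     + 64 * 2 ^+ k * (kappa * psi q) ^+ 2) <= delta.
Proof.
move=> k0 eta0 delta1 eta_le psiS kS qE N.
have P2 : 2 <= 2 ^+ k :> R by rewrite ler_eXnr// ?ler1n.
set P := 2 ^+ k in eta_le P2 *.
apply: (@le_trans _ _ (\sum_(1 <= q < N) ((2 / eta + 64 * P) * kappa ^+ 2 * psi q ^+ 2
    + 2 * eta * ((s q * f q)%:R ^+ 2)^-1))).
  (* AM-GM: [2 r c <= r ^ 2 / eta + eta c ^ 2] *)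
  apply: ler_sum => q _; rewrite -exprVn; set c := (_%:R^-1).
  rewrite -subr_ge0 [leRHS](_ : _ = 2 / eta * (kappa * psi q - eta * c) ^+ 2).
    by rewrite mulr_ge0 ?sqr_ge0// divr_ge0// ltW.
  by field; rewrite gt_eqF.
rewrite big_split/= -!mulr_sumr.
have c4 := sum_inv_sq_decomposition R s f N qE.
have k2 : kappa ^+ 2 * \sum_(1 <= q < N) psi q ^+ 2 <= eta ^+ 2.
  by apply: le_trans kS; rewrite ler_wpM2l ?sqr_ge0.
apply: (@le_trans _ _ ((2 / eta + 64 * P) * eta ^+ 2 + 2 * eta * 4)).
  rewrite lerD//; last by rewrite ler_wpM2l// mulr_ge0// ltW.
  rewrite -mulrA ler_wpM2l// addr_ge0 ?divr_ge0 ?mulr_ge0 ?exprn_ge0//; exact: ltW.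
rewrite [leLHS](_ : _ = 10 * eta + 64 * P * eta ^+ 2); last first.
  by field; rewrite gt_eqF.
(* From [12 P eta <= delta < 1] and [P >= 2] follows [eta <= delta / 24]; so
   [10 eta <= 5 delta / 12] and [64 P eta ^ 2 <= 16 delta eta / 3 <= 2 delta / 9]. *)
nra.
Qed.

Lemma bad_sets_measure (R : realType) (psi : nat -> R) (k : nat)
    (kappa S eta delta : R) :
  (forall q : nat, (0 < q)%N -> 0 <= psi q) ->
  (forall q : nat, (0 < q)%N -> (k < num_prime_divisors q)%N -> psi q = 0) ->
  (0 < k)%N -> 0 <= kappa -> 0 < eta -> delta < 1 -> 12 * 2 ^+ k * eta <= delta ->
  (forall N, \sum_(1 <= q < N) psi q ^+ 2 <= S) -> kappa ^+ 2 * S <= eta ^+ 2 ->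
  (lebesgue_measure (\bigcup_n bad_set R n.+1 (kappa * psi n.+1)%R) <= delta%:E)%E.
Proof.
move=> psi0 psik k0 kappa0 eta0 delta1 eta_le psiS kS.
have P2 : 2 <= 2 ^+ k :> R by rewrite ler_eXnr// ?ler1n.
have kpsi0 q : (0 < q)%N -> 0 <= kappa * psi q by move=> /psi0; exact: mulr_ge0.
(* A single term of the sum gives [(kappa * psi q) ^ 2 <= kappa ^ 2 * S <= eta ^ 2], and
   [eta < 1]. *)
have kpsi1 q : (0 < q)%N -> kappa * psi q < 1.
  move=> q0; have le_eta : (kappa * psi q) ^+ 2 <= eta ^+ 2.
    apply: le_trans kS; rewrite exprMn ler_wpM2l ?sqr_ge0//.
    apply: le_trans (psiS q.+1); rewrite big_nat_recr//= lerDr.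
    by apply: sumr_ge0 => i _; rewrite sqr_ge0.
  have eta1 : eta < 1 by nra.
  apply: le_lt_trans eta1; rewrite -ler_sqr ?nnegrE ?kpsi0//; exact: ltW.
(* A decomposition is chosen for every [q] at once; [q = 0] receives a dummy pair. *)
have /choice[sf sfP] (q : nat) : exists p : nat * nat, (0 < q)%N ->
    q = (p.1 * p.2 ^ 2)%N /\
    (lebesgue_measure (bad_set R q (kappa * psi q)) <=
     (4 * (kappa * psi q) * (p.1 * p.2)%:R^-1
       + 64 * 2 ^+ k * (kappa * psi q) ^+ 2)%:E)%E.
  have [q0|q0] := posnP q; first by exists (0%N, 0%N); rewrite q0.
  have [|s [f sfq]] := bad_set_measure R q k _ q0 (kpsi0 q q0) (kpsi1 q q0).
    by move=> /(psik q q0) ->; rewrite mulr0.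
  by exists (s, f).
apply: le_trans (lebesgue_measure_bigcup _ _) _.
apply: lime_le; first by apply: is_cvg_nneseries => n _ _; exact: measure_ge0.
apply: nearW => N.
have := @sum_bad_set_bound R psi k kappa S eta delta (fun q => (sf q).1)
  (fun q => (sf q).2) k0 eta0 delta1 eta_le psiS kS
  (fun q q0 => (sfP q q0).1) N.+1.
rewrite -lee_fin; apply: le_trans.
rewrite big_add1/= -sumEFin; apply: lee_sum => i _.
exact: (sfP i.+1 isT).2.
Qed.

(** * From the hypothesis on kappa to the measure bound *)

Lemma sumsq_partial_le (R : realType) (psi : nat -> R) (N : nat) :
  (sumsq psi < +oo)%E -> \sum_(1 <= q < N) psi q ^+ 2 <= fine (sumsq psi).
Proof.
move=> Sfin; rewrite -lee_fin fineK.
  by rewrite -sumEFin; apply: nneseries_lim_ge => n _ _; rewrite lee_fin sqr_ge0.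
rewrite ge0_fin_numE//; apply: nneseries_ge0 => n _ _.
by rewrite lee_fin sqr_ge0.
Qed.

(** For [S = 0] the quotient is [+oo] and the hypothesis says nothing, but then the left side of the
    conclusion vanishes. *)
Lemma lt_div_sqrt_sqr_le (R : realType) (delta S c kappa : R) :
  0 <= S -> 0 < delta -> 0 < c -> 0 <= kappa ->
  (kappa%:E < delta%:E / sqrte S%:E * c%:E)%E ->
  kappa ^+ 2 * S <= (delta * c) ^+ 2.
Proof.
rewrite le_eqVlt => /predU1P[<-|S0] d0 c0 k0; first by rewrite mulr0 sqr_ge0.
have sS : 0 < Num.sqrt S by rewrite sqrtr_gt0.
rewrite /= inver gt_eqF// -!EFinM lte_fin => kl.
rewrite -{1}(sqr_sqrtr (ltW S0)) -exprMn ler_sqr ?nnegrE.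
- by move: kl; rewrite mulrAC ltr_pdivlMr// => /ltW.
- by rewrite mulr_ge0// ltW.
- by rewrite ltW// mulr_gt0.
Qed.

Theorem theorem6 (R : realType) (psi : nat -> R)
  (psi_ge0 : forall q : nat, (0 < q)%N -> 0 <= psi q)
  (S_fin : (sumsq psi < +oo)%E)
  (k : nat) (k_gt0 : (0 < k)%N)
  (psi_supp : forall q : nat, (0 < q)%N ->
     (k < num_prime_divisors q)%N -> psi q = 0)
  (delta : R) (delta_gt0 : 0 < delta) (delta_lt1 : delta < 1)
  (kappa : R)
  (kappa_lt : (kappa%:E <
     Order.min (1 / (6 * maxpsi psi)%:E)
    (Order.min (delta%:E / sqrte (sumsq psi)
                  * (4 / (3 * pi ^+ 4))%R%:E * (1 / 2 ^+ k)%R%:E)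
    (Order.min ((delta%:E / sumsq psi) `^ (2 / 3)
                  * ((2 * pi ^+ 2 * Num.sqrt 12
                      * (constA R + constB R * 2 `^ (7 * k%:R / 2)))
                     `^ (- (2 / 3)))%R%:E)
               (sqrte (delta%:E / sumsq psi)
                  * (Num.sqrt (1 / (18 * pi ^+ 2)))%R%:E))))%E) :
  ((1 - delta)%:E <= lebesgue_measure (Bprime psi kappa))%E.
Proof.
move: kappa_lt; rewrite !lt_min => /andP[_ /andP[kappa_lt _]].
have S_ge0 : (0 <= sumsq psi)%E.
  by apply: nneseries_ge0 => n _ _; rewrite lee_fin sqr_ge0.
have SE : sumsq psi = (fine (sumsq psi))%:E by rewrite fineK ?ge0_fin_numE.
rewrite SE -muleA -EFinM in kappa_lt.
(* From here on [delta * c] takes the place of [eta]. *)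
set c := 4 / _ * _ in kappa_lt.
have P0 : 0 < 2 ^+ k :> R by rewrite exprn_gt0.
have pi0 : 0 < pi :> R := pi_gt0 R.
have c0 : 0 < c.
  by rewrite !(mulr_gt0, invr_gt0, divr_gt0, exprn_gt0).
(* The left side equals [16 delta / pi ^ 4], and [pi >= 2]. *)
have c_le : 12 * 2 ^+ k * (delta * c) <= delta.
  have pi16 : 16 <= pi ^+ 4 :> R.
    rewrite (_ : 16 = 2 ^+ 4); last by rewrite -natrX.
    by rewrite lerXn2r ?nnegrE ?pi_ge2 ?pi_ge0.
  rewrite (_ : _ * _ = delta * (16 / pi ^+ 4)); last first.
    rewrite /c; move: pi0 P0; move: pi (2 ^+ k) => p P p0 P0.
    by field; rewrite !gt_eqF.
  by rewrite ler_piMr ?ler_pdivrMr ?mul1r ?exprn_gt0// ltW.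
(* [kappa] may be negative; truncating it at 0 makes the radii nonnegative and only enlarges the bad
   sets. *)
pose kp := Num.max kappa 0.
have kp0 : 0 <= kp by rewrite le_max lexx orbT.
have kpS : kp ^+ 2 * fine (sumsq psi) <= (delta * c) ^+ 2.
  rewrite /kp; case: (leP kappa 0) => [_|k0].
    by rewrite expr0n mul0r sqr_ge0.
  apply: lt_div_sqrt_sqr_le kappa_lt => //; last exact: ltW.
  exact: fine_ge0.
have bad_le := bad_sets_measure R psi k kp _ _ delta psi_ge0 psi_supp k_gt0 kp0
  (mulr_gt0 delta_gt0 c0) delta_lt1 c_le
  (fun N => sumsq_partial_le R psi N S_fin) kpS.
rewrite EFinB leeBlDr//.
(* The goal is now [1 <= lebesgue_measure (Bprime psi kappa) + delta], which follows by covering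
   [0, 1] with [Bprime] and the bad sets. *)
have -> : 1%E = lebesgue_measure (`[0, 1]%classic : set R).
  by rewrite lebesgue_measure_itv/= lte_fin ltr01 oppr0 adde0.
have cover : (`[0, 1]%classic : set R) `<=`
    Bprime psi kappa `|` \bigcup_n bad_set R n.+1 (kp * psi n.+1).
  move=> x x01; have [xB|xB] := pselect (Bprime psi kappa x); [by left|right].
  move: xB => /not_andP[//|/existsNP[q /not_implyP[q0 /negP]]].
  rewrite -leNgt ge_max => /andP[x1 x2].
  have kpsi : kappa * psi q <= kp * psi q.
    by rewrite ler_wpM2r ?psi_ge0// le_max lexx.
  exists q.-1 => //=; rewrite prednK//; split.
  - by move: x01; rewrite /= in_itv.
  - exact: le_trans kpsi.
  - exact: le_trans kpsi.
apply: le_trans (lebesgue_measure_le _ _ _ cover) _.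
apply: le_trans (outer_measureU2 ((wlength idfun)^*)%mu _ _) _.
exact: leeD.
Qed.
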